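(* Let $p$ be an odd prime, $q=p^k$, $r=p^s$ with $s\mid k$, let $n$ be even, let $V_n$ be an $n$-dimensional $\mathbb{F}_p$-vector space with a nondegenerate symmetric bilinear form, let $K_0$ be an $\mathbb{F}_r$-subspace of $\mathbb{F}_q$ and $K_1=\mathbb{F}_q\setminus K_0$. Let $(P^{(z)})_{z\in\mathbb{F}_q}$ be a family of functions $V_n\to\mathbb{F}_r$ which is constant (in $z$) on each of the sets $\{0\}$, $K_0\setminus\{0\}$, $K_1$; denote the corresponding functions by $Q_0,Q_2,Q_1\colon V_n\to\mathbb{F}_r$ respectively, and suppose they are all vectorial bent with weakly regular components. Let $H\colon V_n\times\mathbb{F}_q\times\mathbb{F}_q\to\mathbb{F}_r$, $H(x,y,z)=P^{(z)}(x)+\mathrm{Tr}^k_s(yz)$. Then $H$ is vectorial dual-bent if and only if those of $Q_0,Q_2,Q_1$ which occur (i.e. whose region $\{0\}$, $K_0\setminus\{0\}$, $K_1$, respectively, is nonempty) are of inversion type. In that case, let $G^{(z)}\colon V_n\to\mathbb{F}_r$ be such that $(P^{(z)}_t)^*=\mathrm{Tr}^s_1(t^{-1}G^{(z)})$ for all $t\in\mathbb{F}_r^*$ and $z\in\mathbb{F}_q$, let $K(u,v,w)=G^{(v)}(u)-\mathrm{Tr}^k_s(vw)$, and let $\iota(t)=t^{-1}$ on $\mathbb{F}_r^*$. Then every pair $(H^*,\sigma)$ as in the definition of vectorial dual-bentness of $H$ (i.e. $H^*$ vectorial bent, $\sigma$ a permutation of $\mathbb{F}_r^*$, $(H_t)^*=(H^*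 )_{\sigma(t)}$ for all $t\in\mathbb{F}_r^*$) is of the form $\big((A^\top)^{-1}\circ K,\ A\circ\iota\big)$, equivalently of the form $\big(A^\top\circ K,\ A^{-1}\circ\iota\big)$, with $A$ an $\mathbb{F}_p$-linear permutation of $\mathbb{F}_r$.
   Context: Notation: $\mathrm{Tr}^a_b$ is the trace $\mathbb{F}_{p^a}\to\mathbb{F}_{p^b}$ ($b\mid a$); $\zeta_p=e^{2\pi i/p}$. For an even-dimensional $\mathbb{F}_p$-space $V_n$ of dimension $n$ with nondegenerate symmetric bilinear form $\langle\cdot,\cdot\rangle$ and $f\colon V_n\to\mathbb{F}_p$, the Walsh transform is $W_f(b)=\sum_{x\in V_n}\zeta_p^{f(x)-\langle b,x\rangle}$. $f$ is bent if $|W_f(b)|=p^{n/2}$ for all $b$; then (as $n$ is even) $W_f(b)=\varepsilon_f(b)p^{n/2}\zeta_p^{f^*(b)}$ with $\varepsilon_f(b)\in\{\pm1\}$ and a function $f^*\colon V_n\to\mathbb{F}_p$, the dual of $f$. A bent $f$ is weakly regular if $\varepsilon_f$ is constant. For $P\colon V_n\to\mathbb{F}_r$ and $t\in\mathbb{F}_r^*$ the component is $P_t=\mathrm{Tr}^s_1(tP)$. $P$ is vectorial bent if all $P_t$, $t\ne0$, are bent; it has weakly regular components if every $P_t$ is weakly regular. $P$ is vectorial dual-bent if it is vectorial bent and there are a vectorial bent $P^*\colon V_n\to\mathbb{F}_r$ and a permutation $\sigma$ of $\mathbb{F}_r^*$ with $(P_t)^*=(P^* )_{\sigma(t)}$ for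 all $t\in\mathbb{F}_r^*$. A vectorial bent $P$ is of inversion type if there is $G\colon V_n\to\mathbb{F}_r$ with $(P_t)^*=\mathrm{Tr}^s_1(t^{-1}G)$ for all $t\in\mathbb{F}_r^*$. The same definitions apply to functions on $V=V_n\times\mathbb{F}_q\times\mathbb{F}_q$, which carries the form $\langle(u,v,w),(x,y,z)\rangle=\langle u,x\rangle+\mathrm{Tr}^k_1(vy)+\mathrm{Tr}^k_1(wz)$. For an $\mathbb{F}_p$-linear permutation $A$ of $\mathbb{F}_r$, $A^\top$ denotes its adjoint with respect to the trace form: $\mathrm{Tr}^s_1(A(u)v)=\mathrm{Tr}^s_1(uA^\top(v))$ for all $u,v\in\mathbb{F}_r$. *)

(* Defs.v *)
From HB Require Import structures.
From mathcomp Require Import all_boot all_order all_algebra all_fingroup all_field.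

Set Implicit Arguments.
Unset Strict Implicit.
Unset Printing Implicit Defensive.

Import Order.TTheory GRing.Theory Num.Theory.
Local Open Scope ring_scope.

Section Trace.

Variables (F L : finFieldType) (e : F -> L).

(* For an embedding e : F -> L of finite fields, [L : F] is the logarithm of
   #|L| in base #|F|, and the trace of x is the sum of the x^(#|F|^i) for
   i < [L : F].  This sum lies in L, so the trace is its preimage under e; the
   preimage always exists, hence the default value 0 is never used. *)
Definition ftrace (x : L) : F :=
  odflt 0 [pick y : F |
    e y == \sum_(i < trunc_log #|F| #|L|) x ^+ (#|F| ^ i)].

Definition is_subspace (S : {set L}) : Prop :=
  Algebra.nmod_closed S /\ forall (a : F) (x : L), x \in S -> e a * x \in S.

End Trace.

Section PrimeField.

Variables (p : nat) (L : finFieldType).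

(* The embedding of F_p into a field of characteristic p. *)
Definition fp_emb (c : 'F_p) : L := (nat_of_ord c)%:R.

Definition abs_trace : L -> 'F_p := ftrace fp_emb.

Definition fp_linear (A : L -> L) : Prop :=
  (forall x y, A (x + y) = A x + A y) /\
  (forall (c : 'F_p) x, A (fp_emb c * x) = fp_emb c * A x).

Definition is_adjoint (A B : L -> L) : Prop :=
  forall u v, abs_trace (A u * v) = abs_trace (u * B v).

End PrimeField.

(* e^(2 i pi / p) for p > 1: among the p-th roots of -1, p.-root (-1) is the one
   of minimal nonnegative argument, that is e^(i pi / p). *)
Definition zeta (p : nat) : algC := (p.-root (-1)) ^+ 2.

Section Bent.

(* X is (the underlying set of) an n-dimensional F_p-space and B its form. *)
Variables (p n : nat) (X : finType) (B : X -> X -> 'F_p).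

Definition walsh (f : X -> 'F_p) (b : X) : algC :=
  \sum_(x : X) zeta p ^+ nat_of_ord (f x - B b x).

Definition bent (f : X -> 'F_p) : Prop :=
  forall b, `|walsh f b| = p%:R ^+ n./2.

(* p^(n/2) with sign (-1)^s, times zeta^j; n is even. *)
Definition bent_value (s : bool) (j : 'F_p) : algC :=
  (-1) ^+ s * p%:R ^+ n./2 * zeta p ^+ nat_of_ord j.

(* For f bent, p an odd prime and n even, there is exactly one j for which
   walsh f b is bent_value s j for some s; the default value is not used. *)
Definition dual (f : X -> 'F_p) (b : X) : 'F_p :=
  odflt 0 [pick j : 'F_p | [exists s : bool, walsh f b == bent_value s j]].

Definition weakly_regular (f : X -> 'F_p) : Prop :=
  bent f /\ exists s : bool, forall b, walsh f b = bent_value s (dual f b).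

Variable Fr : finFieldType.

Definition component (P : X -> Fr) (t : Fr) (x : X) : 'F_p :=
  abs_trace p (t * P x).

Definition vectorial_bent (P : X -> Fr) : Prop :=
  forall t : {unit Fr}, bent (component P (val t)).

Definition weakly_regular_components (P : X -> Fr) : Prop :=
  forall t : {unit Fr}, weakly_regular (component P (val t)).

Definition dual_bent_pair (P Ps : X -> Fr) (sigma : {perm {unit Fr}}) : Prop :=
  vectorial_bent Ps /\
  forall t : {unit Fr},
    dual (component P (val t)) =1 component Ps (val (sigma t)).

Definition vectorial_dual_bent (P : X -> Fr) : Prop :=
  vectorial_bent P /\
  exists (Ps : X -> Fr) (sigma : {perm {unit Fr}}), dual_bent_pair P Ps sigma.

Definition inversion_dual (P G : X -> Fr) : Prop :=
  forall t : {unit Fr},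
    dual (component P (val t)) =1 component G (val t)^-1.

Definition inversion_type (P : X -> Fr) : Prop :=
  vectorial_bent P /\ exists G : X -> Fr, inversion_dual P G.

End Bent.

Section Product.

Variables (p : nat) (V : finType) (B : V -> V -> 'F_p) (Fr Fq : finFieldType).
Variable e : Fr -> Fq.

Definition prod_form (a b : V * Fq * Fq) : 'F_p :=
  let: (u, v, w) := a in
  let: (x, y, z) := b in
  B u x + abs_trace p (v * y) + abs_trace p (w * z).

Definition Hfun (P : Fq -> V -> Fr) (a : V * Fq * Fq) : Fr :=
  let: (x, y, z) := a in P z x + ftrace e (y * z).

Definition Kfun (G : Fq -> V -> Fr) (a : V * Fq * Fq) : Fr :=
  let: (u, v, w) := a in G v u - ftrace e (v * w).

End Product.

Arguments prod_form {p V} B Fq a b.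

Section Forms.

Variables (p : nat) (Fr : finFieldType) (X : finType) (K : X -> Fr).
Variables (Hs : X -> Fr) (sigma : {perm {unit Fr}}).

(* In both definitions AT is the adjoint of A. *)

(* (Hs, sigma) = ((A^T)^-1 o K, A o iota) *)
Definition pair_form1 : Prop :=
  exists A AT : {perm Fr},
    [/\ fp_linear p A, is_adjoint p A AT,
        forall a, Hs a = (AT^-1)%g (K a)
      & forall t : {unit Fr}, val (sigma t) = A (val t)^-1].

(* (Hs, sigma) = (A^T o K, A^-1 o iota) *)
Definition pair_form2 : Prop :=
  exists A AT : {perm Fr},
    [/\ fp_linear p A, is_adjoint p A AT,
        forall a, Hs a = AT (K a)
      & forall t : {unit Fr}, val (sigma t) = (A^-1)%g (val t)^-1].

End Forms.

(* Main.v *)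
(* Summing over [y] first gives, for [H_t (x, y, z) = P^(z)_t x + Tr (t y z)],
     W_(H_t) (u, v, w) = q zeta^(- Tr (v w / t)) W_(P^(v / t)_t) u,
   and [P^(v / t) = P^(v)] since the three regions are stable under the units of
   [F_r].  Hence [H_t] is bent, with dual [(P^(v)_t)^* u - Tr (t^-1 Tr (v w))].
   In the inversion case this is [K_(t^-1)], and the same summation shows that
   [K] is vectorial bent.  Conversely, if the dual is [Tr (sigma t Hs)], then
   varying [w] at [v = 1] yields [D] with [Tr (sigma t D c) = Tr (t^-1 c)] for
   all [t] and [c]; nondegeneracy of the trace form makes [D] bijective, which
   forces [t^-1 |-> sigma t] to extend to a linear [A], with adjoint [D^-1].
   Moving [A] to the other side gives [D^-1 o Hs = K]. *)

Require Import Defs.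
From HB Require Import structures.
From mathcomp Require Import all_boot all_order all_algebra all_fingroup all_field.

Set Implicit Arguments.
Unset Strict Implicit.
Unset Printing Implicit Defensive.

Import Order.TTheory GRing.Theory Num.Theory.
Local Open Scope ring_scope.

(** * The relative trace of an extension of finite fields *)

Section FiniteFieldTrace.

Variables (p a m : nat) (F L : finFieldType) (e : {rmorphism F -> L}).
Hypotheses (p_prime : prime p) (cardF : #|F| = (p ^ a)%N).
Hypothesis cardL : #|L| = (#|F| ^ m)%N.

Let pcharL : p \in [pchar L].
Proof. by apply: (@card_finPcharP _ _ (a * m)); rewrite // cardL cardF expnM. Qed.

Let expX_D (x y : L) i : (x + y) ^+ (#|F| ^ i) = x ^+ (#|F| ^ i) + y ^+ (#|F| ^ i).
Proof.
by rewrite exprDn_pchar // cardF -expnM pnatX pnatE // pcharL.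
Qed.

(** The image of [e] already supplies [#|F|] roots of ['X^#|F| - 'X]; a fixed [x] outside it would
    be one root more than the degree allows. *)
Lemma rmorph_fixed_range (x : L) : x ^+ #|F| = x -> exists y, e y = x.
Proof.
move=> fix_x; case: (pickP (fun y => e y == x)) => [y /eqP | no_y]; first by exists y.
have q_gt1 : (1 < #|F|)%N := finNzRing_gt1 F.
have sz : size ('X^#|F| - 'X : {poly L}) = #|F|.+1.
  by rewrite size_polyDl ?size_polyXn // size_polyN size_polyX ltnS.
have nz : 'X^#|F| - 'X != 0 :> {poly L} by rewrite -size_poly_eq0 sz.
have := max_poly_roots (rs := x :: [seq e y | y <- enum F]) nz.
rewrite sz /= size_map -cardE ltnn => contra; suff : false by []; apply: contra.
  rewrite rootE !hornerE ?hornerXn fix_x subrr eqxx /=.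
  apply/allP=> _ /mapP[y _ ->].
  by rewrite rootE !hornerE ?hornerXn -rmorphXn /= expf_card subrr.
rewrite map_inj_uniq ?enum_uniq ?andbT; last exact: fmorph_inj.
by apply/mapP=> -[y _ eq_x]; have := no_y y; rewrite eq_x eqxx.
Qed.

(** The power sum is fixed by [x |-> x ^+ #|F|], hence lies in the image of [e], so the [pick] in
    [ftrace] succeeds. *)
Lemma ftraceE x : e (ftrace e x) = \sum_(i < m) x ^+ (#|F| ^ i).
Proof.
rewrite /ftrace cardL trunc_expnK ?finNzRing_gt1 //.
set S := \sum_(i < m) _.
have [y def_y] : exists y, e y = S.
  apply: rmorph_fixed_range; rewrite /S.
  have -> : (\sum_(i < m) x ^+ (#|F| ^ i)) ^+ #|F|
          = \sum_(i < m) x ^+ (#|F| ^ i.+1).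
    elim/big_rec2: _ => [|i u v _ IH].
      by rewrite expr0n -(prednK (ltnW (finNzRing_gt1 F))).
    by rewrite -[X in _ ^+ X]expn1 expX_D expn1 IH -exprM -expnSr.
  (* Frobenius has shifted every exponent by one; the new top term is [x ^+ #|L| = x], which closes
     the cycle. *)
  case: m cardL => [|m'] cL; first by rewrite !big_ord0.
  rewrite big_ord_recr [RHS]big_ord_recl /= -cL expf_card expn0 expr1 addrC.
  by [].
by case: pickP => [z /eqP | /(_ y)] //=; rewrite def_y eqxx.
Qed.

Lemma ftraceD x y : ftrace e (x + y) = ftrace e x + ftrace e y.
Proof.
apply: (fmorph_inj e); rewrite rmorphD !ftraceE -big_split /=.
by apply: eq_bigr => i _; apply: expX_D.
Qed.

Lemma ftraceZ c x : ftrace e (e c * x) = c * ftrace e x.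
Proof.
apply: (fmorph_inj e); rewrite rmorphM !ftraceE mulr_sumr.
apply: eq_bigr => i _; rewrite exprMn; congr (_ * _).
elim: (i : nat) => [|j IH]; first by rewrite expr1.
by rewrite expnSr exprM IH -rmorphXn /= expf_card.
Qed.

(** If the trace vanished identically, the trace polynomial, of degree [#|F| ^ (m - 1)], would have
    all [#|F| ^ m] elements of [L] as roots. *)
Lemma ftrace_neq0 : exists x, ftrace e x != 0.
Proof.
case: (pickP (fun x => ftrace e x != 0)) => [x | tr0]; first by exists x.
have q_gt1 : (1 < #|F|)%N := finNzRing_gt1 F.
have {tr0} sum0 x : \sum_(i < m) x ^+ (#|F| ^ i) = 0 :> L.
  by rewrite -ftraceE; have /negbFE/eqP-> := tr0 x; rewrite rmorph0.
case: m cardL sum0 => [cL | m' cL sum0].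
  by have := finNzRing_gt1 L; rewrite cL.
pose T : {poly L} := \sum_(i < m'.+1) 'X^(#|F| ^ i).
have szT : size T = (#|F| ^ m').+1.
  rewrite /T big_ord_recr /= addrC size_polyDl ?size_polyXn // ltnS.
  apply: (leq_trans (size_sum _ _ _)); apply/bigmax_leqP => i _.
  by rewrite size_polyXn ltn_exp2l.
have nz : T != 0 by rewrite -size_poly_eq0 szT.
have := max_poly_roots (rs := enum L) nz; rewrite szT -cardE cL ltnS leq_exp2l // ltnn.
move=> contra; suff : false by []; apply: contra; last exact: enum_uniq.
apply/allP => x _; rewrite rootE /T horner_sum -[X in _ == X](sum0 x).
by apply/eqP/eq_bigr => i _; rewrite hornerXn.
Qed.

End FiniteFieldTrace.

(** * The absolute trace: linearity, nondegeneracy and transitivity *)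

Section AbsoluteTrace.

Variables (p : nat) (p_prime : prime p).

(** [fp_emb] is a bare function; identifying it with the structure map of [L] as an algebra over its
    prime field makes the results on [ftrace] applicable to [abs_trace]. *)
Lemma fp_emb_rmorphism (L : finFieldType) k :
  #|L| = (p ^ k)%N -> exists e : {rmorphism 'F_p -> L}, fp_emb L =1 e.
Proof.
move=> cardL; have pcharL : p \in [pchar L] by apply: card_finPcharP cardL _.
pose e : {rmorphism 'F_p -> pPrimeCharType pcharL} := in_alg _.
by exists e => c; rewrite -[LHS]mulr1.
Qed.

Section Field.

Variables (L : finFieldType) (k : nat).
Hypothesis cardL : #|L| = (p ^ k)%N.

Let cardFp : #|{: 'F_p}| = (p ^ 1)%N. Proof. by rewrite card_Fp. Qed.

Let cardL' : #|L| = (#|{: 'F_p}| ^ k)%N. Proof. by rewrite cardFp. Qed.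

Let eq_ftrace (e e' : 'F_p -> L) : e =1 e' -> ftrace e =1 ftrace e'.
Proof.
by move=> ee' x; rewrite /ftrace; congr odflt; apply: eq_pick => y; rewrite /= ee'.
Qed.

Lemma abs_traceE (x : L) : fp_emb L (abs_trace p x) = \sum_(i < k) x ^+ (p ^ i).
Proof.
have [e emb_e] := fp_emb_rmorphism cardL.
by rewrite emb_e /abs_trace (eq_ftrace emb_e) (ftraceE e p_prime cardFp cardL') cardFp.
Qed.

Lemma abs_traceD (x y : L) : abs_trace p (x + y) = abs_trace p x + abs_trace p y.
Proof.
have [e emb_e] := fp_emb_rmorphism cardL.
by rewrite /abs_trace !(eq_ftrace emb_e) (ftraceD e p_prime cardFp cardL').
Qed.

Lemma abs_traceZ c (x : L) : abs_trace p (fp_emb L c * x) = c * abs_trace p x.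
Proof.
have [e emb_e] := fp_emb_rmorphism cardL.
by rewrite /abs_trace emb_e !(eq_ftrace emb_e) (ftraceZ e p_prime cardFp cardL').
Qed.

Lemma abs_trace0 : abs_trace p (0 : L) = 0.
Proof. by apply: (addrI (abs_trace p (0 : L))); rewrite -abs_traceD !addr0. Qed.

Lemma abs_traceN (x : L) : abs_trace p (- x) = - abs_trace p x.
Proof. by apply: (addrI (abs_trace p x)); rewrite -abs_traceD !subrr abs_trace0. Qed.

Lemma abs_traceB (x y : L) : abs_trace p (x - y) = abs_trace p x - abs_trace p y.
Proof. by rewrite abs_traceD abs_traceN. Qed.

Lemma abs_trace_neq0 : exists x : L, abs_trace p x != 0.
Proof.
have [e emb_e] := fp_emb_rmorphism cardL.
have [x tr_x] := ftrace_neq0 e p_prime cardFp cardL'.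
by exists x; rewrite /abs_trace (eq_ftrace emb_e).
Qed.

(** If [x - y] were nonzero, its multiples would fill [L], and the trace would vanish everywhere. *)
Lemma abs_trace_nondeg (x y : L) :
  (forall a, abs_trace p (a * x) = abs_trace p (a * y)) -> x = y.
Proof.
move=> eq_tr; apply/eqP; rewrite -subr_eq0; apply: contraT => nz.
have [z /eqP[]] := abs_trace_neq0.
by rewrite -[z](divfK nz) mulrBr abs_traceB eq_tr subrr.
Qed.

End Field.

(** Transitivity of the trace: the exponents [s * j + i] with [i < s] and [j < m] run exactly once
    through the numbers below [s * m]. *)
Lemma abs_trace_ftrace (F L : finFieldType) (e : {rmorphism F -> L}) s m :
  #|F| = (p ^ s)%N -> #|L| = (p ^ (s * m))%N ->
  forall x, abs_trace p (ftrace e x) = abs_trace p x.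
Proof.
move=> cardF cardL x.
have cardL' : #|L| = (#|F| ^ m)%N by rewrite cardL expnM cardF.
have [eL embL] := fp_emb_rmorphism cardL.
have e_emb c : e (fp_emb F c) = fp_emb L c by rewrite rmorph_nat.
apply: (fmorph_inj eL); rewrite -!embL (abs_traceE cardL) -e_emb.
rewrite (abs_traceE cardF) rmorph_sum /=.
have -> : \sum_(i < s) e (ftrace e x ^+ (p ^ i))
        = \sum_(i < s) \sum_(j < m) x ^+ (p ^ (s * j + i)).
  apply: eq_bigr => i _; rewrite rmorphXn /= (ftraceE e p_prime cardF cardL').
  have pcharL := card_finPcharP cardL p_prime.
  elim/big_rec2: _ => [|j u v _ <-].
    by rewrite expr0n -(prednK (_ : 0 < p ^ i)%N) ?expn_gt0 ?prime_gt0.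
  rewrite exprDn_pchar; last by rewrite pnatX pnatE // pcharL.
  by rewrite -exprM cardF -expnM -expnD.
rewrite exchange_big /=; elim: m {cardL cardL'} => [|m IH].
  by rewrite muln0 !big_ord0.
by rewrite mulnSr big_split_ord big_ord_recr IH.
Qed.

End AbsoluteTrace.

(** * The additive character of the prime field, and duals read off from Walsh values *)

Section AdditiveCharacter.

Variables (p : nat) (p_prime : prime p) (p_odd : odd p).

Definition fp_char (j : 'F_p) : algC := zeta p ^+ nat_of_ord j.

(** The order of [zeta p] divides [p]. Order 1 would make the root [r] of -1 equal to 1, whose
    [p]-th power is not -1, or to -1, although [p.-root] never takes a negative value for
    [p > 1]. *)
Lemma zeta_primitive : p.-primitive_root (zeta p).
Proof.
have p_gt1 := prime_gt1 p_prime.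
pose r : algC := p.-root (-1); have rp : r ^+ p = -1 by apply: rootCK; apply: ltnW.
have zp : zeta p ^+ p = 1 by rewrite /zeta -exprM mulnC exprM rp sqrrN expr1n.
have [m m_prim] := prim_order_exists (prime_gt0 p_prime) zp.
case/primeP: p_prime => _ dvd_p /dvd_p/pred2P[m1 | m_p]; last by rewrite m_p in m_prim.
have /eqP : zeta p = 1 by rewrite -[zeta p]expr1 -m1 prim_expr_order.
rewrite -[_ == _]/(r ^+ 2 == 1) sqrf_eq1 => /orP[] /eqP r_eq.
  move/eqP: rp; rewrite r_eq expr1n -subr_eq0 opprK -(natrD _ 1 1) pnatr_eq0.
  by [].
have := rootC_lt0 (-1 : algC) p_gt1.
by rewrite -/r r_eq oppr_lt0 ltr01.
Qed.

Lemma fp_char_inj : injective fp_char.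
Proof.
move=> i j /eqP; rewrite (eq_prim_root_expr zeta_primitive) => /eqP eq_ij.
apply: val_inj => /=; move: eq_ij.
by rewrite !modn_small // -[X in (_ < X)%N](Fp_cast p_prime).
Qed.

Lemma fp_char0 : fp_char 0 = 1. Proof. by []. Qed.

Lemma fp_charD i j : fp_char (i + j) = fp_char i * fp_char j.
Proof.
rewrite /fp_char -exprD /= -[RHS](prim_expr_mod zeta_primitive).
by congr (_ ^+ (_ %% _)); exact: Fp_cast.
Qed.

Lemma norm_fp_char i : `|fp_char i| = 1.
Proof.
apply/eqP; rewrite -(@pexpr_eq1 _ _ p) ?prime_gt0 // -normrX.
by rewrite /fp_char exprAC (prim_expr_order zeta_primitive) expr1n normr1.
Qed.

(** Translation by [x0] leaves the sum unchanged but multiplies it by [fp_char (phi x0)], which is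
    not 1. *)
Lemma sum_fp_char_eq0 (X : finZmodType) (phi : X -> 'F_p) :
    (forall x y, phi (x + y) = phi x + phi y) -> (exists x, phi x != 0) ->
  \sum_x fp_char (phi x) = 0.
Proof.
move=> phiD [x0 nz].
have nz1 : fp_char (phi x0) - 1 != 0.
  by rewrite subr_eq0 -fp_char0 (inj_eq fp_char_inj).
apply: (mulfI nz1); rewrite mulr0 mulrBl mul1r; apply/eqP; rewrite subr_eq0.
rewrite mulr_sumr [X in _ == X](reindex_inj (addrI x0)).
by apply/eqP/eq_bigr => x _; rewrite phiD fp_charD.
Qed.

(** Squaring removes the sign and doubles the exponent, and 2 is invertible modulo the odd prime
    [p]. This is what makes [dual] well defined. *)
Lemma bent_value_inj n s s' (j j' : 'F_p) :
  bent_value n s j = bent_value n s' j' -> j = j'.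
Proof.
have p_nz : p%:R != 0 :> algC by rewrite pnatr_eq0 -lt0n prime_gt0.
move/(congr1 (fun z => (z / p%:R ^+ n./2) ^+ 2)).
rewrite /bent_value -!/(fp_char _) ![_ * _ * fp_char _]mulrAC !mulfK ?expf_neq0 //.
rewrite !exprMn !sqrr_sign !mul1r !expr2 -!fp_charD => /fp_char_inj.
have two_nz : 2%:R != 0 :> 'F_p.
  rewrite -(dvdn_pcharf (pchar_Fp p_prime)); apply: contraL p_odd.
  move=> p2; have := dvdn_leq (isT : 0 < 2)%N p2.
  by rewrite leq_eqVlt ltnNge prime_gt1 // orbF => /eqP->.
by move=> eq2; apply: (mulfI two_nz); rewrite !mulr_natl !mulr2n.
Qed.

Lemma norm_bent_value n s (j : 'F_p) : `|bent_value n s j| = p%:R ^+ n./2.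
Proof.
rewrite /bent_value -/(fp_char _) !normrM normr_sign mul1r norm_fp_char mulr1.
by rewrite ger0_norm // exprn_ge0.
Qed.

Lemma dual_eq n (X : finType) (B : X -> X -> 'F_p) f b s j :
  walsh B f b = bent_value n s j -> dual n B f b = j.
Proof.
move=> Wfb; rewrite /dual; case: pickP => [i /existsP[s' /eqP] | /(_ j)/existsP[]] /=.
  by rewrite Wfb => /bent_value_inj.
by exists s; rewrite Wfb.
Qed.

Lemma eq_walsh (X : finType) (B : X -> X -> 'F_p) f g :
  f =1 g -> walsh B f =1 walsh B g.
Proof. by move=> fg b; apply: eq_bigr => x _; rewrite fg. Qed.

Lemma eq_dual n (X : finType) (B : X -> X -> 'F_p) f g :
  f =1 g -> dual n B f =1 dual n B g.
Proof.
move=> fg b; rewrite /dual; congr odflt; apply: eq_pick => j /=.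
by apply: eq_existsb => s; rewrite (eq_walsh B fg).
Qed.

Lemma eq_bent n (X : finType) (B : X -> X -> 'F_p) f g :
  f =1 g -> bent n B f -> bent n B g.
Proof. by move=> fg bent_f b; rewrite -(eq_walsh B fg). Qed.

Lemma eq_weakly_regular n (X : finType) (B : X -> X -> 'F_p) f g :
  f =1 g -> weakly_regular n B f -> weakly_regular n B g.
Proof.
move=> fg [bent_f [s Wf]]; split; first exact: eq_bent fg bent_f.
by exists s => b; rewrite -(eq_walsh B fg) -(eq_dual n B fg).
Qed.

End AdditiveCharacter.

(** * Walsh transforms of duals and of functions on the product space *)

Section WalshTransform.

Variables (p : nat) (p_prime : prime p) (p_odd : odd p).

(** Fourier inversion: since the sign is constant, it leaves the sum, and the transform of the dual
    is, up to a constant factor, the double transform of [f], that is [p ^ n] times the character at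
    [f (- x)]. *)
Lemma weakly_regular_dual_bent n (X : finZmodType) (B : X -> X -> 'F_p) f :
    ~~ odd n -> #|X| = (p ^ n)%N ->
    (forall x y z, B (x + y) z = B x z + B y z) -> (forall x y, B x y = B y x) ->
    (forall x, (forall b, B b x = 0) -> x = 0) ->
  weakly_regular n B f -> bent n B (dual n B f).
Proof.
move=> n_even cardX BD BC B_nondeg [_ [s Wf]] x.
have BDr y z t : B y (z + t) = B y z + B y t by rewrite BC BD !(BC y).
have p_gt0 : 0 < p%:R :> algC by rewrite ltr0n prime_gt0.
have sum_dual : (-1) ^+ s * p%:R ^+ n./2 * walsh B (dual n B f) x
              = p%:R ^+ n * fp_char (f (- x)).
  transitivity (\sum_b \sum_y fp_char (f y) * fp_char (- B b (y + x))).
    rewrite mulr_sumr; apply: eq_bigr => b _.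
    rewrite -/(fp_char _) fp_charD // mulrA.
    rewrite -[_ * fp_char (dual _ _ _ _)]/(bent_value n s _) -Wf.
    rewrite mulr_suml; apply: eq_bigr => y _.
    by rewrite -/(fp_char _) -!fp_charD // BDr (BC x) opprD addrA.
  (* By nondegeneracy the sum over [b] vanishes unless [y = - x]. *)
  rewrite exchange_big (bigD1 (- x)) //= [X in _ + X]big1 => [|y y_x].
    rewrite -mulr_sumr addNr addr0 mulrC; congr (_ * _).
    transitivity (\sum_(b : X) (1 : algC)); last by rewrite sumr_const cardX natrX.
    apply: eq_bigr => b _; suff -> : B b 0 = 0 by rewrite oppr0.
    by apply: (addrI (B b 0)); rewrite -BDr !addr0.
  rewrite -mulr_sumr sum_fp_char_eq0 ?mulr0 // => [b c|]; first by rewrite BD opprD.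
  case: (pickP (fun b => - B b (y + x) != 0)) => [b | B0]; first by exists b.
  case/negP: y_x; rewrite -addr_eq0; apply/eqP/B_nondeg => b.
  by have /negbFE := B0 b; rewrite oppr_eq0 => /eqP.
have := congr1 Num.norm sum_dual; rewrite !normrM norm_fp_char // normr_sign mul1r mulr1.
rewrite !(ger0_norm (exprn_ge0 _ (ltW p_gt0))).
rewrite -{3}(even_halfK n_even) -addnn exprD.
by apply: mulfI; rewrite expf_neq0 // gt_eqF.
Qed.

Section Product.

Variables (L : finFieldType) (k : nat).
Hypothesis cardL : #|L| = (p ^ k)%N.

Lemma sum_fp_char_trace (c : L) :
  \sum_(y : L) fp_char (abs_trace p (c * y)) = if c == 0 then p%:R ^+ k else 0.
Proof.
case: eqVneq => [-> | nz].
  transitivity (\sum_(y : L) (1 : algC)); last by rewrite sumr_const cardL natrX.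
  by apply: eq_bigr => y _; rewrite mul0r (abs_trace0 p_prime cardL).
apply: sum_fp_char_eq0 => // [x y|]; first by rewrite mulrDr (abs_traceD p_prime cardL).
have [z tr_z] := abs_trace_neq0 p_prime cardL.
by exists (c^-1 * z); rewrite mulVKf.
Qed.

Lemma sum_fp_char_bilinear (X : finType) (F : L -> X -> 'F_p) (c v w : L) :
    c != 0 ->
  \sum_x \sum_y \sum_z fp_char (F z x + abs_trace p (c * (y * z))
                                - abs_trace p (v * y) - abs_trace p (w * z))
  = p%:R ^+ k * fp_char (- abs_trace p (w * v / c)) * \sum_x fp_char (F (v / c) x).
Proof.
move=> c_nz; rewrite mulr_sumr; apply: eq_bigr => x _.
transitivity (\sum_z fp_char (F z x - abs_trace p (w * z))
              * \sum_y fp_char (abs_trace p ((c * z - v) * y))).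
  rewrite exchange_big; apply: eq_bigr => z _; rewrite mulr_sumr.
  apply: eq_bigr => y _; rewrite -fp_charD //; congr fp_char.
  rewrite mulrBl (abs_traceB p_prime cardL) -[c * z * y]mulrA [z * y]mulrC.
  by rewrite -!addrA; congr (_ + _); rewrite addrA addrC.
(* The sum over [y] is nonzero only when [c * z = v]. *)
rewrite (bigD1 (v / c)) //= [X in _ + X]big1 ?addr0 => [|z z_v].
  rewrite sum_fp_char_trace mulrC mulrCA mulfV // mulr1 subrr eqxx mulrA.
  by rewrite fp_charD // -mulrA -!mulrA; congr (_ * _); rewrite mulrC.
rewrite sum_fp_char_trace subr_eq0 ifN ?mulr0 //.
by apply: contra z_v => /eqP<-; rewrite mulrC mulKf.
Qed.

Variables (X : finType) (B : X -> X -> 'F_p) (F : L -> X -> 'F_p) (c : L).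
Hypothesis c_nz : c != 0.

Let sum3 (f : X * L * L -> algC) :
  \sum_a f a = \sum_x \sum_y \sum_z f (x, y, z).
Proof.
rewrite (pair_bigA _ (fun x y => \sum_z f (x, y, z))) /=.
rewrite (pair_bigA _ (fun (a : X * L) z => f (a.1, a.2, z))) /=.
by apply: eq_bigr => -[[x y] z].
Qed.

Lemma walsh_prod u v w :
  walsh (prod_form B L)
    (fun a => F a.2 a.1.1 + abs_trace p (c * (a.1.2 * a.2))) (u, v, w)
  = p%:R ^+ k * fp_char (- abs_trace p (w * v / c)) * walsh B (F (v / c)) u.
Proof.
rewrite [walsh B _ _](eq_bigr (fun x => fp_char (F (v / c) x - B u x))) //.
rewrite -(sum_fp_char_bilinear (fun z x => F z x - B u x)) // [LHS]sum3.
apply: eq_bigr => x _; apply: eq_bigr => y _; apply: eq_bigr => z _.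
congr (fp_char _); rewrite -[LHS]/(F z x + abs_trace p (c * (y * z))
  - (B u x + abs_trace p (v * y) + abs_trace p (w * z))).
by rewrite !opprD -!addrA [X in _ + X = _]addrCA.
Qed.

(** In [Kfun] the family is indexed by the middle coordinate instead of the last, so the roles of
    [v] and [w] are exchanged. *)
Lemma walsh_prod_swap u v w :
  walsh (prod_form B L)
    (fun a => F a.1.2 a.1.1 + abs_trace p (c * (a.1.2 * a.2))) (u, v, w)
  = p%:R ^+ k * fp_char (- abs_trace p (v * w / c)) * walsh B (F (w / c)) u.
Proof.
rewrite [walsh B _ _](eq_bigr (fun x => fp_char (F (w / c) x - B u x))) //.
rewrite -(sum_fp_char_bilinear (fun z x => F z x - B u x)) // [LHS]sum3.
apply: eq_bigr => x _; rewrite exchange_big; apply: eq_bigr => z _; apply: eq_bigr => y _.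
congr (fp_char _); rewrite -[LHS]/(F y x + abs_trace p (c * (y * z))
  - (B u x + abs_trace p (v * y) + abs_trace p (w * z))).
rewrite !opprD [y * z]mulrC -!addrA [X in _ + X = _]addrCA.
by rewrite [- abs_trace p (v * y) - _]addrC.
Qed.

End Product.

End WalshTransform.

(** * Maps that are dual to each other under the trace form *)

Section TraceDuality.

Variables (p s : nat) (p_prime : prime p) (F : finFieldType).
Hypothesis cardF : #|F| = (p ^ s)%N.

Section Dual.

Variables A D : F -> F.
Hypothesis AD : forall a c, abs_trace p (A a * D c) = abs_trace p (a * c).

Lemma trace_dual_injl : injective A.
Proof.
move=> a b eqA; apply: (abs_trace_nondeg p_prime cardF) => c.
by rewrite ![c * _]mulrC -(AD a) -(AD b) eqA.
Qed.

Lemma trace_dual_injr : injective D.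
Proof.
move=> c d eqD; apply: (abs_trace_nondeg p_prime cardF) => a.
by rewrite -(AD a c) -(AD a d) eqD.
Qed.

(** [D] is injective on a finite set, hence onto. Thus values of [A] may be tested against the
    [D c], where the trace form no longer sees [A] and is linear in its argument. *)
Lemma trace_dual_linear : fp_linear p A.
Proof.
have surj y : exists c, y = D c.
  by have /codomP := inj_card_onto trace_dual_injr (leqnn _) y.
split=> [x y | a x]; apply: (abs_trace_nondeg p_prime cardF) => z.
  have [c ->] := surj z; rewrite mulrC AD mulrDl mulrDr [D c * A x]mulrC [D c * A y]mulrC.
  by rewrite !(abs_traceD p_prime cardF) !AD.
have [c ->] := surj z; rewrite mulrC AD [D c * _]mulrC -!mulrA.
by rewrite !(abs_traceZ p_prime cardF) AD.
Qed.

End Dual.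

Lemma unit_perm_adjoint (sigma : {perm {unit F}}) (D : F -> F) :
    (forall t c, abs_trace p (val (sigma t) * D c) = abs_trace p ((val t)^-1 * c)) ->
  exists A AT : {perm F},
    [/\ fp_linear p A, is_adjoint p A AT
      & forall t : {unit F}, val (sigma t) = A (val t)^-1].
Proof.
(* [A0] is [t^-1 |-> sigma t], extended by 0 at 0, where [insub] fails. *)
move=> sD; pose A0 x := oapp (fun t => val (sigma t)) 0 (insub x^-1 : option {unit F}).
have A0V t : A0 (val t)^-1 = val (sigma t) by rewrite /A0 invrK valK.
have AD a c : abs_trace p (A0 a * D c) = abs_trace p (a * c).
  rewrite /A0; case: insubP => [t _ def_t | ] /=; first by rewrite sD def_t invrK.
  by rewrite unitfE invr_eq0 negbK => /eqP->; rewrite !mul0r.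
(* The adjoint is the inverse of [D]: write the second factor as a value of [D] and apply [AD]. *)
exists (perm (trace_dual_injl AD)), (perm (trace_dual_injr AD))^-1%g; split=> [|u v|t].
- have [AD1 AZ] := trace_dual_linear AD.
  by split=> *; rewrite !permE ?AD1 ?AZ.
- by rewrite -{1}[v](permKV (perm (trace_dual_injr AD))) !permE AD.
by rewrite permE A0V.
Qed.

End TraceDuality.

(** * Equivalence of the two descriptions of the pairs *)

Section PairForms.

Variables (p : nat) (F : finFieldType).

Lemma fp_linear_permV (A : {perm F}) : fp_linear p A -> fp_linear p (A^-1)%g.
Proof.
move=> [AD AZ]; split=> [x y | c x]; apply: (@perm_inj _ A); rewrite !permKV.
  by rewrite AD !permKV.
by rewrite AZ permKV.
Qed.

Lemma is_adjoint_permV (A AT : {perm F}) :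
  is_adjoint p A AT -> is_adjoint p (A^-1)%g (AT^-1)%g.
Proof. by move=> adjA u v; rewrite -{1}[v](permKV AT) -adjA permKV. Qed.

(** Replacing [A] by its inverse, whose adjoint is the inverse of [AT], exchanges the two forms. *)
Lemma pair_form12 (X : finType) (K Hs : X -> F) sigma :
  pair_form1 p K Hs sigma <-> pair_form2 p K Hs sigma.
Proof.
split=> -[A [AT [linA adjA defH defs]]]; exists (A^-1)%g, (AT^-1)%g.
  by split; rewrite ?invgK //; [apply: fp_linear_permV | apply: is_adjoint_permV].
by split; rewrite ?invgK //; [apply: fp_linear_permV | apply: is_adjoint_permV].
Qed.

End PairForms.

(** * The function [H], its dual and the pairs realizing dual-bentness *)

Section Construction.

Variables (p k s n m : nat) (p_prime : prime p) (p_odd : odd p) (n_even : ~~ odd n).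
Variables (Fr Fq : finFieldType) (e : {rmorphism Fr -> Fq}).
Hypotheses (cardFr : #|Fr| = (p ^ s)%N) (cardFq : #|Fq| = (p ^ (s * m))%N).
Hypothesis def_k : k = (s * m)%N.
Variables (X : finZmodType) (B : X -> X -> 'F_p).
Hypothesis cardX : #|X| = (p ^ n)%N.
Hypothesis BD : forall x y z, B (x + y) z = B x z + B y z.
Hypothesis BC : forall x y, B x y = B y x.
Hypothesis B_nondeg : forall x, (forall b, B b x = 0) -> x = 0.

Variable P : Fq -> X -> Fr.
Hypothesis P_wr : forall z, weakly_regular_components n B (P z).
(** This is the form in which the stability of the three regions under units of [Fr] enters. *)
Hypothesis P_scale : forall (c : Fr) z, c != 0 -> P (e c * z) =1 P z.

Local Notation N := (n + k + k)%N.
Local Notation BN := (prod_form B Fq).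
Local Notation H := (Hfun e P).

Let cardFqk : #|Fq| = (p ^ k)%N. Proof. by rewrite def_k. Qed.

Let cardFqm : #|Fq| = (#|Fr| ^ m)%N. Proof. by rewrite cardFr -expnM. Qed.

Let halfN : N./2 = (k + n./2)%N.
Proof. by rewrite -addnA addnn halfD odd_double andbF add0n doubleK addnC. Qed.

Lemma abs_trace_mul_ftrace c x :
  abs_trace p (c * ftrace e x) = abs_trace p (e c * x).
Proof.
rewrite -(ftraceZ e p_prime cardFr cardFqm).
by rewrite (abs_trace_ftrace p_prime e cardFr cardFq).
Qed.

Let val_neq0 (t : {unit Fr}) : val t != 0. Proof. by rewrite -unitfE (valP t). Qed.

(** The sign [b] is that of the component of [P v], so it may change with [v]. *)
Lemma walsh_Hfun (t : {unit Fr}) u v w :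
  exists b, walsh BN (component p H (val t)) (u, v, w) =
    bent_value N b (dual n B (component p (P v) (val t)) u
                    - abs_trace p ((val t)^-1 * ftrace e (v * w))).
Proof.
have [_ [b Wb]] := P_wr v t; exists b.
have c_nz : e (val t) != 0 by rewrite fmorph_eq0.
(* Transitivity of the trace brings the component into the shape treated by [walsh_prod], with
   [c = e (val t)]. *)
pose g (a : X * Fq * Fq) := component p (P a.2) (val t) a.1.1
   + abs_trace p (e (val t) * (a.1.2 * a.2)).
have /(eq_walsh BN)-> : component p H (val t) =1 g.
  case=> [[x y] z]; rewrite /g /component /Hfun /= mulrDr.
  by rewrite (abs_traceD p_prime cardFr) abs_trace_mul_ftrace.
rewrite (walsh_prod p_prime cardFqk B (fun z => component p (P z) (val t))) //.
have /(eq_walsh B)-> : component p (P (v / e (val t))) (val t) =1 component p (P v) (val t).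
  by move=> x; rewrite /component [v / _]mulrC -fmorphV P_scale ?invr_eq0.
rewrite Wb /bent_value halfN exprD addrC -/(fp_char _) -[in RHS]/(fp_char _) fp_charD //.
rewrite abs_trace_mul_ftrace fmorphV [w * v]mulrC [v * w / _]mulrC.
by rewrite mulrACA [X in X * _]mulrCA.
Qed.

Lemma dual_Hfun (t : {unit Fr}) u v w :
  dual N BN (component p H (val t)) (u, v, w) =
    dual n B (component p (P v) (val t)) u
    - abs_trace p ((val t)^-1 * ftrace e (v * w)).
Proof. by have [b] := walsh_Hfun t u v w; apply: dual_eq. Qed.

Lemma Hfun_vectorial_bent : vectorial_bent N BN H.
Proof.
by move=> t [[u v] w]; have [b ->] := walsh_Hfun t u v w; apply: norm_bent_value.
Qed.

(** Once [A] is moved across the trace, [AT o Hs] satisfies the equations that characterize [Kfun],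
    with parameter [t^-1] in place of [sigma t]. *)
Lemma dual_pair_adjoint Hs sigma :
    dual_bent_pair N BN H Hs sigma ->
  exists A AT : {perm Fr},
    [/\ fp_linear p A, is_adjoint p A AT,
        forall t : {unit Fr}, val (sigma t) = A (val t)^-1
      & forall (t : {unit Fr}) u v w,
          dual n B (component p (P v) (val t)) u
          - abs_trace p ((val t)^-1 * ftrace e (v * w))
          = abs_trace p ((val t)^-1 * AT (Hs (u, v, w)))].
Proof.
move=> [_ dualH].
have eqH (t : {unit Fr}) u v w : abs_trace p (val (sigma t) * Hs (u, v, w)) =
   dual n B (component p (P v) (val t)) u - abs_trace p ((val t)^-1 * ftrace e (v * w)).
  by rewrite -dual_Hfun dualH.
have [x0 tr_x0] := ftrace_neq0 e p_prime cardFr cardFqm.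
have tr0 : ftrace e 0 = 0.
  rewrite -[RHS](mul0r (ftrace e 0)) -(ftraceZ e p_prime cardFr cardFqm).
  by rewrite rmorph0 mul0r.
(* [D c] is the decrement of [Hs (0, 1, w)] from [w = 0] to a [w] of relative
   trace [c]. *)
pose D c := Hs (0, 1, 0) - Hs (0, 1, e (c / ftrace e x0) * x0).
have sD (t : {unit Fr}) c :
    abs_trace p (val (sigma t) * D c) = abs_trace p ((val t)^-1 * c).
  (* Both points have [u = 0] and [v = 1], so the duals of the components of [P 1] cancel and only
     the trace terms, 0 and [c], remain. *)
  rewrite mulrBr (abs_traceB p_prime cardFr) !eqH !mul1r (ftraceZ e p_prime cardFr cardFqm).
  rewrite divfK // tr0 mulr0 (abs_trace0 p_prime cardFr) subr0.
  by rewrite opprB addrC subrK.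
have [A [AT [linA adjA defs]]] := unit_perm_adjoint p_prime cardFr sD.
by exists A, AT; split=> // t u v w; rewrite -eqH defs adjA.
Qed.

Lemma dual_pair_inversion_dual Hs sigma :
    dual_bent_pair N BN H Hs sigma ->
  exists G, forall z, inversion_dual n B (P z) (G z).
Proof.
move=> /dual_pair_adjoint[A [AT [_ _ _ dualP]]].
(* At [w = 0] the trace term disappears. *)
exists (fun v u => AT (Hs (u, v, 0))); move=> v t u.
rewrite /component -dualP mulr0 abs_trace_mul_ftrace mulr0.
by rewrite (abs_trace0 p_prime cardFqk) subr0.
Qed.

(** [AT o Hs] and [Kfun e G] have the same trace against every [t^-1], hence against every field
    element, so they agree by nondegeneracy. *)
Lemma dual_pair_form1 (G : Fq -> X -> Fr) Hs sigma :
    (forall z, inversion_dual n B (P z) (G z)) ->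
  dual_bent_pair N BN H Hs sigma -> pair_form1 p (Kfun e G) Hs sigma.
Proof.
move=> dualG /dual_pair_adjoint[A [AT [linA adjA defs dualP]]].
exists A, AT; split=> // -[[u v] w].
apply: (@perm_inj _ AT); rewrite permKV /=.
apply: (abs_trace_nondeg p_prime cardFr) => a; have [-> | nz] := eqVneq a 0.
  by rewrite !mul0r.
have Ua : a^-1 \is a GRing.unit by rewrite unitrV unitfE.
have := dualP (Sub a^-1 Ua) u v w; rewrite dualG SubK invrK => <-.
by rewrite /component mulrBr (abs_traceB p_prime cardFr).
Qed.

(** The component of [G z] at [t] is the dual of the weakly regular component of [P z] at [t^-1],
    hence bent. *)
Lemma Kfun_vectorial_bent (G : Fq -> X -> Fr) :
    (forall z, inversion_dual n B (P z) (G z)) ->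
  vectorial_bent N BN (Kfun e G).
Proof.
move=> dualG t [[u v] w].
have c_nz : - e (val t) != 0 by rewrite oppr_eq0 fmorph_eq0.
pose g (a : X * Fq * Fq) := component p (G a.1.2) (val t) a.1.1
   + abs_trace p (- e (val t) * (a.1.2 * a.2)).
have /(eq_walsh BN)-> : component p (Kfun e G) (val t) =1 g.
  case=> [[x y] z]; rewrite /g /component /Kfun /= mulrBr.
  rewrite (abs_traceB p_prime cardFr) abs_trace_mul_ftrace.
  by rewrite mulNr (abs_traceN p_prime cardFqk).
rewrite (walsh_prod_swap p_prime cardFqk B (fun z => component p (G z) (val t))) //.
set z := w / _.
have /(eq_walsh B)<- : dual n B (component p (P z) (val t^-1%g)) =1 component p (G z) (val t).
  by move=> x; rewrite dualG FinRing.val_unitV invrK.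
rewrite !normrM norm_fp_char // mulr1 ger0_norm ?exprn_ge0 // halfN exprD; congr (_ * _).
by apply: weakly_regular_dual_bent => //; apply: P_wr.
Qed.

Lemma Hfun_vectorial_dual_bent (G : Fq -> X -> Fr) :
    (forall z, inversion_dual n B (P z) (G z)) ->
  vectorial_dual_bent N BN H.
Proof.
move=> dualG; split; first exact: Hfun_vectorial_bent.
exists (Kfun e G), (perm (@invg_inj {unit Fr})).
split=> [|t [[u v] w]]; first exact: Kfun_vectorial_bent.
rewrite dual_Hfun dualG permE FinRing.val_unitV.
by rewrite /component /Kfun mulrBr (abs_traceB p_prime cardFr).
Qed.

End Construction.

(** * Transfer along pointwise equality, from [P z] to the function of its region and back *)

Section Extensionality.

Variables (p n : nat) (X : finType) (B : X -> X -> 'F_p) (F : finFieldType).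
Variables P Q : X -> F.
Hypothesis PQ : P =1 Q.

Lemma eq_weakly_regular_components :
  weakly_regular_components n B P -> weakly_regular_components n B Q.
Proof.
by move=> wrP t; apply: eq_weakly_regular (wrP t) => x; rewrite /component PQ.
Qed.

Lemma eq_inversion_dual G : inversion_dual n B P G -> inversion_dual n B Q G.
Proof.
move=> dualG t x; rewrite -dualG; apply: eq_dual => y.
by rewrite /component PQ.
Qed.

End Extensionality.

(** * The equivalence and the description of all pairs *)

Theorem proposition3p3 (p k s n : nat)
  (p_prime : prime p) (p_odd : odd p) (s_dvd_k : (s %| k)%N) (n_even : ~~ odd n)
  (Fr Fq : finFieldType) (card_Fr : #|Fr| = (p ^ s)%N) (card_Fq : #|Fq| = (p ^ k)%N)
  (e : {rmorphism Fr -> Fq})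
  (V : vectType 'F_p) (dimV : \dim {:V} = n)
  (B : {symmetric (finvect_type V)}) (B_nondeg : nondegenerate B)
  (K0 : {set Fq}) (K0_sub : is_subspace e K0)
  (P : Fq -> finvect_type V -> Fr) (Q0 Q2 Q1 : finvect_type V -> Fr)
  (P_0 : P 0 =1 Q0)
  (P_K0 : forall z, z \in K0 :\ 0 -> P z =1 Q2)
  (P_K1 : forall z, z \in ~: K0 -> P z =1 Q1)
  (Q0_bent : vectorial_bent n B Q0 /\ weakly_regular_components n B Q0)
  (Q2_bent : K0 :\ 0 != set0 ->
     vectorial_bent n B Q2 /\ weakly_regular_components n B Q2)
  (Q1_bent : ~: K0 != set0 ->
     vectorial_bent n B Q1 /\ weakly_regular_components n B Q1) :
  let N := (n + k + k)%N in
  let BN := prod_form B Fq in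
  let H := Hfun e P in
  (vectorial_dual_bent N BN H <->
     [/\ inversion_type n B Q0,
         K0 :\ 0 != set0 -> inversion_type n B Q2
       & ~: K0 != set0 -> inversion_type n B Q1]) /\
  (vectorial_dual_bent N BN H ->
     forall G : Fq -> finvect_type V -> Fr,
       (forall z, inversion_dual n B (P z) (G z)) ->
       let K := Kfun e G in
       (forall (Hs : finvect_type V * Fq * Fq -> Fr) (sigma : {perm {unit Fr}}),
          dual_bent_pair N BN H Hs sigma -> pair_form1 p K Hs sigma) /\
       (forall (Hs : finvect_type V * Fq * Fq -> Fr) (sigma : {perm {unit Fr}}),
          pair_form1 p K Hs sigma <-> pair_form2 p K Hs sigma)).
Proof.
move=> N BN H.
have def_k : k = (s * (k %/ s))%N by rewrite mulnC divnK.
have cardFq' : #|Fq| = (p ^ (s * (k %/ s)))%N by rewrite -def_k.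
have cardV : #|finvect_type V| = (p ^ n)%N.
  have := card_vspacef (Vector.class (finvect_type V : vectType 'F_p)).
  by rewrite card_vspace card_Fp // -dimV => ->.
have BC x y : B x y = B y x by rewrite hermC expr0 mul1r.
have B_inj x : (forall b, B b x = 0) -> x = 0.
  move=> Bx; apply/eqP; rewrite -memv0 -(eqP B_nondeg).
  by apply/mem_orthovP => b _; rewrite BC.
have region z : [\/ z = 0, z \in K0 :\ 0 | z \in ~: K0].
  have [-> | z_nz] := eqVneq z 0; first by constructor 1.
  by case: (boolP (z \in K0)) => zK; [constructor 2 | constructor 3]; rewrite !inE ?z_nz.
have nonempty (S : {set Fq}) z : z \in S -> S != set0 by move=> Sz; apply/set0Pn; exists z.
have P_wr z : weakly_regular_components n B (P z).
  case: (region z) => [-> | zK | zK].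
  - by apply: eq_weakly_regular_components (proj2 Q0_bent) => x; rewrite P_0.
  - apply: eq_weakly_regular_components (proj2 (Q2_bent (nonempty _ _ zK))) => x.
    by rewrite P_K0.
  - apply: eq_weakly_regular_components (proj2 (Q1_bent (nonempty _ _ zK))) => x.
    by rewrite P_K1.
have [_ K0_scale] := K0_sub.
have P_scale c z : c != 0 -> P (e c * z) =1 P z.
  move=> c_nz x; have ec_nz : e c != 0 by rewrite fmorph_eq0.
  case: (region z) => [-> | | ] ; first by rewrite mulr0.
    rewrite !inE => /andP[z_nz zK]; rewrite !P_K0 // !inE ?z_nz //.
    by rewrite mulf_neq0 //= K0_scale.
  (* If [e c * z] were in [K0], scaling by [c^-1] would bring [z] into [K0]. *)
  rewrite !inE => zK; rewrite !P_K1 // !inE //; apply: contra zK => /(K0_scale c^-1).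
  by rewrite fmorphV mulKf.
have BD : forall x y z, B (x + y) z = B x z + B y z by move=> x y z; rewrite linearDl.
split.
  split=> [[_ [Hs [sigma dualH]]] | [inv0 inv2 inv1]].
    have [G dualG] := dual_pair_inversion_dual p_prime p_odd card_Fr cardFq' def_k
      P_wr P_scale dualH.
    split=> [|/[dup]/Q2_bent[Q2_vb _] /set0Pn[z zK]|/[dup]/Q1_bent[Q1_vb _] /set0Pn[z zK]].
    - split; [exact: (proj1 Q0_bent) | exists (G 0)].
      exact (eq_inversion_dual P_0 (dualG 0)).
    - split=> //; exists (G z); exact (eq_inversion_dual (P_K0 _ zK) (dualG z)).
    - split=> //; exists (G z); exact (eq_inversion_dual (P_K1 _ zK) (dualG z)).
  have [_ [G0 dualG0]] := inv0.
  (* For an empty region [G0] is a placeholder, which [G] never takes from that region. *)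
  have [G2 dualG2] : exists G2, K0 :\ 0 != set0 -> inversion_dual n B Q2 G2.
    by case: eqVneq inv2 => [_ _ | _ /(_ isT)[_ [G2 ?]]]; [exists G0 | exists G2].
  have [G1 dualG1] : exists G1, ~: K0 != set0 -> inversion_dual n B Q1 G1.
    by case: eqVneq inv1 => [_ _ | _ /(_ isT)[_ [G1 ?]]]; [exists G0 | exists G1].
  pose G z := if z == 0 then G0 else if z \in K0 then G2 else G1.
  apply: (@Hfun_vectorial_dual_bent p k s n (k %/ s) p_prime p_odd n_even Fr Fq e
    card_Fr cardFq' def_k _ B cardV BD BC B_inj P P_wr P_scale G) => z.
  rewrite /G; case: (region z) => [-> | zK | zK].
  - by rewrite eqxx; apply: eq_inversion_dual dualG0 => x; rewrite P_0.
  - have := zK; rewrite !inE => /andP[/negPf-> ->].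
    by apply: eq_inversion_dual (dualG2 (nonempty _ _ zK)) => x; rewrite P_K0.
  have zNK : z \notin K0 by move: zK; rewrite !inE.
  (* The subspace [K0] contains 0. *)
  have /negPf-> : z != 0 by apply: contraNneq zNK => ->; case: K0_sub => -[].
  rewrite (negPf zNK).
  by apply: eq_inversion_dual (dualG1 (nonempty _ _ zK)) => x; rewrite P_K1.
move=> _ G dualG K; split=> Hs sigma; last exact: pair_form12.
exact: (dual_pair_form1 p_prime p_odd card_Fr cardFq' def_k P_wr P_scale dualG).
Qed.
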